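(* Let $\mathbf{N},\mathbf{M}$ be finitary structures, with $h:\mathbf{N}\hookrightarrow\mathbf{M}$ an interpretation-embedding giving the exact sequence $1\to\mathrm{Aut}(\mathbf{M}/N)\to\mathrm{Aut}(\mathbf{M})\xrightarrow{\hat h}\mathrm{Aut}(\mathbf{N})\to 1$, where $\hat{h}:\mathrm{Aut}(\mathbf{M})\twoheadrightarrow\mathrm{Aut}(\mathbf{N})$ is the restriction homomorphism. Suppose there exists an injective homomorphism $\hat{g}:\mathrm{Aut}(\mathbf{N})\hookrightarrow\mathrm{Aut}(\mathbf{M})$ which is a section of $\hat h$, i.e. $\hat h\circ\hat g=\mathrm{id}_{\mathrm{Aut}(\mathbf{N})}$. Then there exists a set of first-order imaginaries $A\subseteq\mathbf{M}^{eq}$ such that the embedding of structures $h\mathbf{N}\subseteq\mathbf{M}^{eq}$ gives rise to an $\mathfrak{M}$-isomorphism $g:h\mathbf{N}\cong\mathbf{M}/A$ satisfying (1) $M\subseteq\mathrm{dcl}_{\mathbf{M}^{eq}}(hN\cup A)$, and (2) $\mathrm{dcl}_{\mathbf{M}^{eq}}(A)\cap\mathrm{dcl}_{h\mathbf{N}^{eq}}(hN)=\mathrm{dcl}_{h\mathbf{N}^{eq}}(\emptyset)$. Conversely, if there exist $A\subseteq \mathbf{M}^{eq}$ and an interpretation-isomorphism $g:h\mathbf{N}\cong\mathbf{M}/A$ satisfying (1) and (2), then the corresponding homomorphism $\hat g:\mathrm{Aut}(\mathbf{N})\hookrightarrow\mathrm{Aut}(\mathbf{M})$ is a section of $\hat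 h$.
   Context: Structures are multi-sorted and considered in a language powerful enough that a subset of a structure is definable (without parameters) iff it is invariant under all automorphisms of the structure. A sort of $\mathbf{M}$ is $D/E$ with $D$ a parameter-free definable subset of a product of sorts and $E$ a definable equivalence relation; $\mathbf{M}^{Eq}$ is the structure having all such sorts; $\mathbf{M}^{eq}$ is the usual extension by first-order imaginary sorts. $\mathrm{dcl}_{\mathbf{K}}$ denotes definable closure in the structure $\mathbf{K}$. For $A\subseteq\mathbf{M}^{Eq}$, $\mathbf{M}/A$ is the expansion of $\mathbf{M}$ by names for the elements of $A$, and $\mathrm{Aut}(\mathbf{M}/A)$ is the pointwise stabiliser of $A$. An interpretation (pre-morphism) $g:\mathbf{N}\to\mathbf{M}$ is an injective map $N\to\mathbf{M}^{Eq}$ onto a sort such that the image of each basic relation/operation of $\mathbf{N}$ is definable; $g\mathbf{N}$ denotes the image with the image relations. Two interpretations are identified if there is a bijection between their images definable in $\mathbf{M}^{Eq}$. $g$ is an embedding if $g\mathbf{N}$ has no proper expansion definable in $\mathbf{M}^{Eq}$, a surjection if $M\subseteq\mathrm{dcl}(gN)$ (in $\mathbf{M}^{Eq}$), and an $\mathfrak{M}$-isomorphism (interpretation-isomorphism) if both; an interpretation $g$ of $\mathbf{N}$ in $\mathbf{M}$ induces the restriction homomorphism $\hat g$ between automorphism groups, and an $\mathfrak{M}$-isomorphism $\mathbf{N}\cong\mathbf{M}/A$ induces $\mathrm{Aut}(\mathbf{N})\cong\mathrm{Aut}(\mathbf{M}/A)\subseteq\mathrm{Aut}(\mathbf{M})$.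 A structure $\mathbf{M}$ is finitary if $\mathbf{M}=\bigcup_{\alpha<\kappa}\mathbf{M}_\alpha$ with each $\mathbf{M}_\alpha$ a finite first-order $0$-definable substructure.
   Formalization: The section ĝ is assumed continuous (the claim fails for abstract homomorphisms of profinite groups), and in the converse g is required to be identified with the inclusion of hN by a definable bijection commuting with the maps (otherwise ĝ need not be a section). *)

(* Defs.v *)
From HB Require Import structures.
From mathcomp Require Import all_boot.
From mathcomp Require Import boolp classical_sets cardinality.

Set Implicit Arguments.
Unset Strict Implicit.
Unset Printing Implicit Defensive.

Local Open Scope classical_set_scope.

(* Typed de Bruijn variables.  A finite list of sorts serves both as the arity
   of a symbol and as the context of a formula; [env X w] is the product of the
   sorts [X s] along the list [w]. *)
Inductive var {S : Type} : seq S -> S -> Type :=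
| vz w s : var (s :: w) s
| vs w s t : var w s -> var (t :: w) s.

Definition env {S : Type} (X : S -> Type) (w : seq S) : Type :=
  forall s, var w s -> X s.

Definition emap {S : Type} (X Y : S -> Type) (f : forall s, X s -> Y s)
  (w : seq S) (e : env X w) : env Y w := fun s v => f s (e s v).

Definition enil {S : Type} (X : S -> Type) : env X [::] :=
  fun s v => match v in var w s return
               (if w is [::] then X s else unit) with
             | vz _ _ => tt | vs _ _ _ _ => tt end.

Definition econs {S : Type} (X : S -> Type) (t : S) (x : X t) (w : seq S)
    (e : env X w) : env X (t :: w) :=
  fun s v =>
    match v in var w' s'
      return (if w' is t' :: w'' then X t' -> env X w'' -> X s' else unit)
    with
    | vz _ _ => fun x _ => x
    | vs _ s' _ v' => fun _ e => e s' v'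
    end x e.

Definition env1 {S : Type} (X : S -> Type) (t : S) (x : X t) : env X [:: t] :=
  econs x (enil X).

Fixpoint var_l {S : Type} (w w' : seq S) (s : S) (v : var w s) :
    var (w ++ w') s :=
  match v with
  | vz w s => vz (w ++ w') s
  | vs _ _ t v => vs t (var_l w' v)
  end.

Fixpoint var_r {S : Type} (w w' : seq S) (s : S) (v : var w' s) :
    var (w ++ w') s :=
  match w with
  | [::] => v
  | t :: w => vs t (var_r w v)
  end.

Record signature := Signature {
  sorts : Type;
  rels : Type;
  rel_ar : rels -> seq sorts;
  ops : Type;
  op_dom : ops -> seq sorts;
  op_cod : ops -> sorts
}.

Record structure := Structure {
  sig :> signature;
  carrier : sorts sig -> Type;
  rel_in : forall r : rels sig, set (env carrier (rel_ar r));
  op_in : forall f : ops sig, env carrier (op_dom f) -> carrier (op_cod f)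
}.

Definition pts (M : structure) : Type := {s : sorts M & carrier s}.

Inductive term (L : signature) (w : seq (sorts L)) : sorts L -> Type :=
| tvar s : var w s -> term w s
| tapp (f : ops L) : (forall s, var (op_dom f) s -> term w s) ->
    term w (op_cod f).

Inductive formula (L : signature) : seq (sorts L) -> Type :=
| fbot w : formula w
| feq w s : term w s -> term w s -> formula w
| frel w (r : rels L) : (forall s, var (rel_ar r) s -> term w s) -> formula w
| fimp w : formula w -> formula w -> formula w
| fall w (s : sorts L) : formula (s :: w) -> formula w.

Fixpoint eval (M : structure) w (e : env (@carrier M) w) s (t : term w s) :
    carrier s :=
  match t with
  | tvar s v => e s v
  | tapp f a => op_in (fun s v => eval e (a s v))
  end.

Fixpoint sat (M : structure) w (p : formula w) : set (env (@carrier M) w) :=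
  match p with
  | fbot _ => fun=> False
  | feq _ _ t u => fun e => eval e t = eval e u
  | frel _ r a => fun e => rel_in (r := r) (fun s v => eval e (a s v))
  | fimp _ p q => fun e => sat p e -> sat q e
  | fall _ s p => fun e => forall x : carrier s, sat p (econs x e)
  end.

Definition fo_definable (M : structure) w (D : set (env (@carrier M) w)) :=
  exists p : formula w, D = sat p.

Definition fo_definable2 (M : structure) w w'
    (E : env (@carrier M) w -> env (@carrier M) w' -> Prop) :=
  fo_definable [set e : env (@carrier M) (w ++ w') |
    E (fun s v => e s (var_l w' v)) (fun s v => e s (var_r w v))].

Definition finitary (M : structure) : Prop :=
  exists (I : Type) (P : I -> forall s : sorts M, set (carrier s)),
  [/\ forall i, finite_set [set x : pts M | P i (tag x) (tagged x)],
      forall i (f : ops M) (e : env (@carrier M) (op_dom f)),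
        (forall s v, P i s (e s v)) -> P i _ (op_in e),
      forall i s,
        fo_definable [set e : env (@carrier M) [:: s] | P i s (e s (vz _ _))]
    & forall s (x : carrier s), exists i, P i s x].

Record aut (M : structure) := Aut {
  aut_fun : forall s : sorts M, carrier s -> carrier s;
  aut_inv : forall s : sorts M, carrier s -> carrier s;
  aut_funK : forall s, cancel (@aut_fun s) (@aut_inv s);
  aut_invK : forall s, cancel (@aut_inv s) (@aut_fun s);
  aut_rel : forall (r : rels M) e, rel_in (r := r) (emap aut_fun e) <-> rel_in e;
  aut_op : forall (f : ops M) e,
    aut_fun (op_in (f := f) e) = op_in (emap aut_fun e)
}.

Lemma emapK (S : Type) (X Y : S -> Type) (f : forall s, X s -> Y s)
  (g : forall s, Y s -> X s) : (forall s, cancel (@f s) (@g s)) ->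
  forall w, cancel (@emap S X Y f w) (@emap S Y X g w).
Proof. by move=> fK w e; apply/functional_extensionality_dep => s; apply/funext => v; apply: fK. Qed.

Lemma aut_eq (M : structure) (a b : aut M) :
  (forall s, @aut_fun M a s =1 @aut_fun M b s) -> a = b.
Proof.
case: a b => [f f' fK f'K fr fo] [g g' gK g'K gr go] /= fg.
have efg : f = g by apply: functional_extensionality_dep => s; apply/funext/fg.
subst g; have efg' : f' = g'.
  apply: functional_extensionality_dep => s; apply/funext => x.
  by rewrite -{1}(g'K s x) fK.
subst g'.
by congr Aut; apply: Prop_irrelevance.
Qed.

HB.instance Definition _ (M : structure) := gen_eqMixin (aut M).
HB.instance Definition _ (M : structure) := gen_choiceMixin (aut M).

Section AutGroup.
Variable M : structure.
Implicit Types a b : aut M.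

Definition aut1 : aut M.
Proof. by exists (fun s x => x) (fun s x => x). Defined.

Definition aut_invg a : aut M.
Proof.
exists (@aut_inv M a) (@aut_fun M a).
- exact: aut_invK.
- exact: aut_funK.
- by move=> r e; rewrite -(aut_rel a) (emapK (@aut_invK M a)).
- move=> f e; rewrite -[in LHS](emapK (@aut_invK M a) e) -(aut_op a).
  by rewrite aut_funK.
Defined.

Definition aut_mul a b : aut M.
Proof.
exists (fun s x => aut_fun a (aut_fun b x)) (fun s x => aut_inv b (aut_inv a x)).
- by move=> s x; rewrite aut_funK aut_funK.
- by move=> s x; rewrite aut_invK aut_invK.
- by move=> r e; rewrite -[X in _ <-> X](aut_rel b) -[X in _ <-> X](aut_rel a).
- by move=> f e; rewrite !aut_op.
Defined.

Fact aut_mulA : associative aut_mul. Proof. by move=> *; apply: aut_eq. Qed.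
Fact aut_mul1g : left_id aut1 aut_mul. Proof. by move=> *; apply: aut_eq. Qed.
Fact aut_mulg1 : right_id aut1 aut_mul. Proof. by move=> *; apply: aut_eq. Qed.
Fact aut_mulVg : left_inverse aut1 aut_invg aut_mul.
Proof. by move=> a; apply: aut_eq => s x; apply: aut_funK. Qed.
Fact aut_mulgV : right_inverse aut1 aut_invg aut_mul.
Proof. by move=> a; apply: aut_eq => s x; apply: aut_invK. Qed.

HB.instance Definition _ := isGroup.Build (aut M)
  aut_mulA aut_mul1g aut_mulg1 aut_mulVg aut_mulgV.

End AutGroup.

(* The automorphism group of a finitary structure is profinite for the topology
   of pointwise convergence, in which the pointwise stabilisers of finite sets
   form a neighbourhood base at 1.  Homomorphisms between such groups are meant
   to be continuous; this is continuity for a homomorphism f. *)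
Definition continuous_hom (N M : structure) (f : aut N -> aut M) : Prop :=
  forall (t : sorts M) (y : carrier t), exists F : set (pts N),
    finite_set F /\
    forall a : aut N,
      (forall x, F x -> aut_fun a (tagged x) = tagged x) ->
      aut_fun (f a) y = y.

(* Structures are considered in a language in which the definable relations are
   exactly those invariant under all automorphisms. *)
Definition definable (M : structure) w (D : set (env (@carrier M) w)) :=
  forall (a : aut M) e, D (emap (aut_fun a) e) <-> D e.

Record EqSort (M : structure) := MkEqSort {
  ar : seq (sorts M);
  dom : set (env (@carrier M) ar);
  eqv : env (@carrier M) ar -> env (@carrier M) ar -> Prop;
  dom_definable : definable dom;
  eqv_definable : forall (a : aut M) e e',
    eqv (emap (aut_fun a) e) (emap (aut_fun a) e') <-> eqv e e';
  eqv_refl : forall e, dom e -> eqv e e;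
  eqv_sym : forall e e', dom e -> dom e' -> eqv e e' -> eqv e' e;
  eqv_trans : forall e e' e'', dom e -> dom e' -> dom e'' ->
    eqv e e' -> eqv e' e'' -> eqv e e''
}.

Arguments dom {M} _ _.
Arguments eqv {M} _ _ _.
Arguments dom_definable {M} _ _ _.
Arguments eqv_definable {M} _ _ _ _.
Arguments eqv_refl {M} _ _ _.
Arguments eqv_sym {M} _ _ _ _ _ _.
Arguments eqv_trans {M} _ _ _ _ _ _ _ _ _.

Definition El (M : structure) (S : EqSort M) : Type :=
  {C : set (env (@carrier M) (ar S)) |
    exists2 e, dom S e & C = [set e' | dom S e' /\ eqv S e e']}.

(* The underlying set of M^Eq. *)
Definition MEq (M : structure) : Type := {S : EqSort M & El S}.

(* M^eq, as a subset of M^Eq. *)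
Definition first_order (M : structure) (S : EqSort M) : Prop :=
  fo_definable (dom S) /\ fo_definable2 (eqv S).

Definition eq_part (M : structure) : set (MEq M) :=
  [set x : MEq M | first_order (tag x)].

Arguments eq_part : clear implicits.

Definition act (M : structure) (a : aut M) (S : EqSort M) (C : El S) : El S.
Proof.
exists [set e | sval C (emap (aut_inv a) e)].
case: C => C /= [e De ->]; exists (emap (aut_fun a) e).
  by rewrite dom_definable.
apply/seteqP; split=> e' /=.
  move=> [] /(dom_definable S a) + /(eqv_definable S a).
  by rewrite (emapK (@aut_invK M a)).
by rewrite -{1 2}(emapK (@aut_invK M a) e') dom_definable eqv_definable.
Defined.

Definition actE (M : structure) (a : aut M) (x : MEq M) : MEq M :=
  existT _ (tag x) (act a (tagged x)).

Section Home.
Variables (M : structure) (s : sorts M).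

Definition home_sort : EqSort M.
Proof.
exists [:: s] setT (fun e e' => e = e') => //.
- move=> a e e'; split=> [|->//] E.
  by rewrite -(emapK (@aut_funK M a) e) E (emapK (@aut_funK M a)).
- by move=> e e' e'' _ _ _ -> ->.
Defined.

Definition home_el (x : carrier s) : El home_sort.
Proof.
exists [set env1 x]; exists (env1 x) => //.
by apply/seteqP; split=> e /= => [-> //|[_ ->]].
Defined.

End Home.

(* The inclusion of M in M^eq. *)
Definition home (M : structure) (x : pts M) : MEq M :=
  existT _ (home_sort (tag x)) (home_el (tagged x)).

Arguments home : clear implicits.

Definition stab (M : structure) (B : set (MEq M)) : set (aut M) :=
  [set a | forall x, B x -> actE a x = x].

Definition dcl_Eq (M : structure) (B : set (MEq M)) : set (MEq M) :=
  [set x | forall a, stab B a -> actE a x = x].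

Definition dcl_eq (M : structure) (B : set (MEq M)) : set (MEq M) :=
  dcl_Eq B `&` eq_part M.

Lemma act_eq (M : structure) (S : EqSort M) (C D : El S) :
  sval C = sval D -> C = D.
Proof. by case: C D => [C pC] [D pD] /= CD; apply: eq_exist. Qed.

Lemma actM (M : structure) (a b : aut M) (S : EqSort M) (C : El S) :
  act (a * b)%g C = act a (act b C).
Proof. exact: act_eq. Qed.

Lemma act1 (M : structure) (S : EqSort M) (C : El S) : act 1%g C = C.
Proof. exact: act_eq. Qed.

Lemma actK (M : structure) (a : aut M) (S : EqSort M) :
  cancel (@act M a S) (@act M a^-1%g S).
Proof. by move=> C; rewrite -actM mulVg act1. Qed.

Lemma actVK (M : structure) (a : aut M) (S : EqSort M) :
  cancel (@act M a^-1%g S) (@act M a S).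
Proof. by move=> C; rewrite -actM mulgV act1. Qed.

Definition Eq_definable (M : structure) (I : Type) (T : I -> EqSort M) w
    (R : set (env (fun i => El (T i)) w)) : Prop :=
  forall (a : aut M) e, R (emap (fun i => @act M a (T i)) e) <-> R e.

(* Every sort of N is mapped bijectively onto a sort of M^Eq.  As imap is
   bijective on each sort, the image of a relation is its preimage under the
   inverse; that the graph of an operation is invariant means that the
   operation is equivariant. *)
Record interp (N M : structure) := Interp {
  isort : sorts N -> EqSort M;
  imap : forall s : sorts N, carrier s -> El (isort s);
  iinv : forall s : sorts N, El (isort s) -> carrier s;
  imapK : forall s, cancel (@imap s) (@iinv s);
  iinvK : forall s, cancel (@iinv s) (@imap s);
  imap_inj : injective
    (fun x : pts N => existT _ (isort (tag x)) (imap (tagged x)) : MEq M);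
  irel : forall r : rels N,
    Eq_definable [set e | rel_in (r := r) (emap iinv e)];
  iop : forall (f : ops N) (a : aut M) (e : env (fun s => El (isort s)) (op_dom f)),
    imap (op_in (emap iinv (emap (fun s => @act M a (isort s)) e))) =
    act a (imap (op_in (emap iinv e)))
}.

Arguments irel {N M} _ _ _ _.
Arguments iop {N M} _ _ _ _.

(* The map N -> M^Eq. *)
Definition imapE (N M : structure) (h : interp N M) (x : pts N) : MEq M :=
  existT _ (isort h (tag x)) (imap h (tagged x)).

(* Every relation on the image of N which is definable in M^Eq is already
   definable in the image structure: no proper expansion of it is
   definable in M^Eq. *)
Definition interp_embedding (N M : structure) (g : interp N M) : Prop :=
  forall w (R : set (env (@carrier N) w)),
    Eq_definable [set e | R (emap (@iinv N M g) e)] -> definable R.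

Definition interp_surjection (N M : structure) (g : interp N M) : Prop :=
  range (home M) `<=` dcl_Eq (range (imapE g)).

Definition interp_iso (N M : structure) (g : interp N M) : Prop :=
  interp_embedding g /\ interp_surjection g.

(* Two interpretations of N in M are identified when some bijection between
   their images, compatible with the two maps, is definable in M^Eq. *)
Definition same_interp (N M : structure) (g g' : interp N M) : Prop :=
  exists phi : forall s, El (isort g s) -> El (isort g' s),
  [/\ forall s, bijective (phi s),
      forall s x, phi s (imap g x) = imap g' x
    & forall (a : aut M) s x, phi s (act a x) = act a (phi s x)].

Section Restriction.
Variables (N M : structure) (h : interp N M).

(* The restriction of an automorphism of M to (the image of) N. *)
Definition hat (a : aut M) : aut N.
Proof.
exists (fun s x => iinv (act a (imap h x)))
       (fun s x => iinv (act a^-1%g (imap h x))).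
- by move=> s x; rewrite iinvK actK imapK.
- by move=> s x; rewrite iinvK actVK imapK.
- move=> r e; have := irel h r a (emap (@imap _ _ h) e).
  by rewrite /= (emapK (@imapK _ _ h)).
- move=> f e; have := iop h f a (emap (@imap _ _ h) e).
  by rewrite (emapK (@imapK _ _ h)) => <-; rewrite imapK.
Defined.

Fact hatM : {morph hat : a b / (a * b)%g}.
Proof. by move=> a b; apply: aut_eq => s x /=; rewrite iinvK actM. Qed.

HB.instance Definition _ := isMultiplicative.Build (aut M) (aut N) hat hatM.

(* 1 -> Aut(M/N) -> Aut(M) -> Aut(N) -> 1 *)
Definition exact_restriction : Prop :=
  [set a | hat a = 1%g] = stab (range (imapE h)) /\ range hat = setT.

(* The structure hN: the image of N with the image relations. *)
Definition image_structure : structure := {|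
  sig := sig N;
  carrier := fun s => El (isort h s);
  rel_in := fun r => [set e | rel_in (r := r) (emap (@iinv N M h) e)];
  op_in := fun f e => imap h (op_in (emap (@iinv N M h) e))
|}.

(* The inclusion of hN in M^Eq. *)
Definition inclusion : interp image_structure M.
Proof.
apply: (@Interp image_structure M (isort h) (fun s (x : El (isort h s)) => x)
  (fun s (x : El (isort h s)) => x)) => //.
- move=> [s x] [t y] /= xy; rewrite -(iinvK x) -(iinvK y).
  suff /(congr1 (fun z : pts N => existT (fun s => El (isort h s)) (tag z) (imap h (tagged z)))) :
    (existT _ s (iinv x) : pts N) = existT _ t (iinv y) by [].
  by apply: (@imap_inj _ _ h) => /=; rewrite !iinvK.
- by move=> r a e; apply: (irel h r a e).
- by move=> f a e; apply: (iop h f a e).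
Defined.

End Restriction.

Definition MEq_data (M : structure) (x : MEq M) :
    {w : seq (sorts M) & (set (env (@carrier M) w) *
      (env (@carrier M) w -> env (@carrier M) w -> Prop) *
      set (env (@carrier M) w))%type} :=
  existT _ (ar (tag x)) (dom (tag x), eqv (tag x), sval (tagged x)).

Lemma MEq_data_inj (M : structure) : injective (@MEq_data M).
Proof.
move=> [[w d e p1 p2 p3 p4 p5] [C pC]] [[w' d' e' q1 q2 q3 q4 q5] [C' qC]] E.
move: (projT1_eq E) (projT2_eq E) => {E}; rewrite /= in C' qC *.
move=> ww'; destruct ww' => /= -[dd' ee' CC']; subst d' e' C'.
by rewrite (Prop_irrelevance q1 p1) (Prop_irrelevance q2 p2)
  (Prop_irrelevance q3 p3) (Prop_irrelevance q4 p4) (Prop_irrelevance q5 p5)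
  (Prop_irrelevance qC pC).
Qed.

Section Expansion.
Variables (M : structure) (A : set (MEq M)).

(* An imaginary in A is a class of tuples of M; it is named by a new basic
   relation holding of the members of that class. *)
Definition expansion : structure := {|
  sig := {|
    sorts := sorts M;
    rels := (rels M + {x : MEq M | A x})%type;
    rel_ar := fun r => match r with
                       | inl r => rel_ar r
                       | inr x => ar (tag (sval x)) end;
    ops := ops M;
    op_dom := @op_dom M;
    op_cod := @op_cod M |};
  carrier := @carrier M;
  rel_in := fun r => match r with
                     | inl r => rel_in (r := r)
                     | inr x => sval (tagged (sval x)) end;
  op_in := @op_in M
|}.

Definition reduct (a : aut expansion) : aut M.
Proof.
apply: (@Aut M (fun s (x : @carrier M s) => @aut_fun expansion a s x)
  (fun s (x : @carrier M s) => @aut_inv expansion a s x)).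
- exact: (@aut_funK expansion a).
- exact: (@aut_invK expansion a).
- by move=> r e; apply: (@aut_rel expansion a (inl r) e).
- by move=> f e; apply: (@aut_op expansion a f e).
Defined.

Definition sort_expansion (S : EqSort M) : EqSort expansion.
Proof.
apply: (@MkEqSort expansion (ar S) (fun e => dom S e) (fun e e' => eqv S e e')).
- by move=> a e; apply: (dom_definable S (reduct a) e).
- by move=> a e e'; apply: (eqv_definable S (reduct a) e e').
- exact: (eqv_refl S).
- exact: (eqv_sym S).
- exact: (eqv_trans S).
Defined.

Lemma act_expansion (a : aut expansion) (S : EqSort M) (C : El S) :
  act a (C : El (sort_expansion S)) = act (reduct a) C.
Proof. exact: act_eq. Qed.

(* An interpretation in M, seen as an interpretation in M/A. *)
Definition interp_over (N : structure) (h : interp N M) : interp N expansion.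
Proof.
apply: (@Interp N expansion (fun s => sort_expansion (isort h s))
  (fun s x => imap h x) (fun s x => @iinv N M h s x)).
- exact: (@imapK _ _ h).
- exact: (@iinvK _ _ h).
- move=> x y /(congr1 (@MEq_data expansion)) xy.
  by apply: (@imap_inj _ _ h); apply: MEq_data_inj; exact: xy.
- move=> r a e; rewrite -[X in _ <-> X](irel h r (reduct a) e) /=.
  suff -> : emap (fun s => @act _ a (sort_expansion (isort h s))) e =
            emap (fun s => @act _ (reduct a) (isort h s)) e by [].
  apply: functional_extensionality_dep => s; apply/funext => v.
  exact: act_expansion.
- move=> f a e; rewrite [RHS]act_expansion -iop.
  suff -> : emap (fun s => @act _ a (sort_expansion (isort h s))) e =
            emap (fun s => @act _ (reduct a) (isort h s)) e by [].
  apply: functional_extensionality_dep => s; apply/funext => v.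
  exact: act_expansion.
Defined.

End Expansion.

(* For an interpretation-isomorphism g : hN -> M/A, the homomorphism
   f : Aut(N) = Aut(hN) -> Aut(M/A) <= Aut(M) inverse to the restriction
   Aut(M/A) -> Aut(hN) induced by g. *)
Definition corresponding_hom (N M : structure) (h : interp N M)
    (A : set (MEq M)) (g : interp (image_structure h) (expansion A))
    (f : aut N -> aut M) : Prop :=
  forall b : aut N, exists2 a : aut (expansion A), reduct a = f b &
    forall (s : sorts N) (x : @carrier N s),
      @aut_fun (image_structure h) (hat g a) s (imap h x) =
      imap h (aut_fun b x).

(* dcl_{M^eq}(A), intersected with (hN)^Eq.  The elements of (hN)^Eq are
   imaginaries over imaginaries of M, and Aut(M) acts on them through its
   restriction to hN. *)
Definition dcl_in_image (N M : structure) (h : interp N M) (A : set (MEq M)) :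
    set (MEq (image_structure h)) :=
  [set x | forall a, stab A a -> actE (hat (inclusion h) a) x = x].

Arguments dcl_in_image {N M} h A _.

(* Main.v *)
Require Import Defs.
From HB Require Import structures.
From mathcomp Require Import all_boot.
From mathcomp Require Import boolp classical_sets cardinality filter.

(* Given the section gh, let H be its image and A the set of first-order
   imaginaries fixed by H.  The point is that the stabiliser of A is H.  By
   continuity of gh it is enough that an automorphism stabilising A agrees with
   an element of H on each finite set, which we may take to be a finite
   0-definable set B; enumerate B by a tuple m.  The H-orbit of m is a class of
   an invariant equivalence relation on the finite orbit of m, and invariant
   relations on a finite 0-definable set are first-order, because an elementary
   map between subsets of a structure which is a union of finite 0-definable
   sets extends to an automorphism.  So that orbit is an element of A.

   Conversely, (1) makes the restriction from the stabiliser of A to Aut(N)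
   injective, the embedding hypothesis makes its image dense, and compactness of
   Aut(M) makes it surjective with a continuous inverse. *)

Set Implicit Arguments.
Unset Strict Implicit.
Unset Printing Implicit Defensive.

Local Open Scope classical_set_scope.

(** * Dependent pairs, finite sets and typed tuples *)

Lemma existT_injr (I : Type) (P : I -> Type) (i : I) (x y : P i) :
  existT P i x = existT P i y -> x = y.
Proof. exact: (@existT_inj2 {classic I}). Qed.

Lemma finite_set_ind (T : Type) (P : set T -> Prop) :
  P set0 -> (forall x X, P X -> P (x |` X)) -> forall X, finite_set X -> P X.
Proof.
move=> P0 PU X /(@finite_seqP {classic T})[s ->].
elim: s => [|x s IHs]; first by rewrite set_nil.
suff -> : [set` x :: s] = x |` [set` s] by apply: PU.
apply/seteqP; split=> y /=; rewrite inE.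
  by case/orP => [/eqP|]; [left|right].
by case=> [->|ys]; rewrite ?eqxx ?ys ?orbT.
Qed.

Section Environments.
Variables (S : Type) (X : S -> Type).

Lemma env_eq w (e e' : env X w) : (forall s v, e s v = e' s v) -> e = e'.
Proof.
by move=> ee'; apply: functional_extensionality_dep => s; apply/funext => v.
Qed.

Lemma var_nil s : var ([::] : seq S) s -> False.
Proof. by move=> v; inversion v. Qed.

(** The index [t :: w] blocks plain case analysis; the explicit match generalises over the whole
    context and asks nothing of the empty one. *)
Lemma var_cons_ind (t : S) w (P : forall s, var (t :: w) s -> Prop) :
  P t (vz w t) -> (forall s v, P s (vs t v)) -> forall s v, P s v.
Proof.
move=> Pz Ps s v; move: P Pz Ps.
refine (match v as v0 in var w0 s0 return
  match w0 as w1 return var w1 s0 -> Prop with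
  | [::] => fun=> True
  | t' :: w' => fun v => forall P : forall s, var (t' :: w') s -> Prop,
      P t' (vz w' t') -> (forall s v, P s (vs t' v)) -> P s0 v
  end v0 with vz _ _ => _ | vs _ _ _ _ => _ end); by move=> P Pz Ps.
Qed.

Lemma var_cat_ind (w w' : seq S) (P : forall s, var (w ++ w') s -> Prop) :
  (forall s (v : var w s), P s (var_l w' v)) ->
  (forall s (v : var w' s), P s (var_r w v)) ->
  forall s v, P s v.
Proof.
elim: w P => [|t w IHw] P Pl Pr //=.
apply: var_cons_ind; first exact: (Pl t (vz w t)).
by apply: IHw => s v; [apply: (Pl s (vs t v))|apply: Pr].
Qed.

Lemma env_nilE (e : env X [::]) : e = enil X.
Proof. by apply: env_eq => s v; case: (var_nil v). Qed.

Lemma env_consE t w (e : env X (t :: w)) :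
  e = econs (e t (vz w t)) (fun s v => e s (vs t v)).
Proof. by apply: env_eq; apply: var_cons_ind. Qed.

Lemma emap_cons (Y : S -> Type) (f : forall s, X s -> Y s) t (x : X t) w
    (e : env X w) : emap f (econs x e) = econs (f t x) (emap f e).
Proof.
apply: functional_extensionality_dep => s; apply/funext; move: s.
by apply: var_cons_ind.
Qed.

Definition ecat w w' (e : env X w) (e' : env X w') : env X (w ++ w').
Proof.
elim: w e => [|t w IHw] e; first exact: e'.
exact: (econs (e t (vz w t)) (IHw (fun s v => e s (vs t v)))).
Defined.

Lemma ecat_l w w' (e : env X w) (e' : env X w') s (v : var w s) :
  ecat e e' (var_l w' v) = e s v.
Proof.
elim: w e s v => [|t w IHw] e s v; first by case: (var_nil v).
by move: s v; apply: var_cons_ind => //= s v; apply: (IHw (fun s v => e s (vs t v))).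
Qed.

Lemma ecat_r w w' (e : env X w) (e' : env X w') s (v : var w' s) :
  ecat e e' (var_r w v) = e' s v.
Proof. by elim: w e => [|t w IHw] e //=; apply: IHw. Qed.

Definition epts w (e : env X w) : set {s & X s} :=
  [set x | exists v : var w (tag x), e _ v = tagged x].

Lemma epts_var w (e : env X w) s (v : var w s) : epts e (existT _ s (e s v)).
Proof. by exists v. Qed.

Lemma epts_nil (e : env X [::]) : epts e = set0.
Proof. by apply/seteqP; split=> [x [v]|//]; case: (var_nil v). Qed.

Lemma epts_cons t (x : X t) w (e : env X w) :
  epts (econs x e) = existT _ t x |` epts e.
Proof.
apply/seteqP; split=> [[s y] [/= v <-{y}]|y [->|[v ev]]].
- by move: s v; apply: var_cons_ind => [|s v]; [left|right; apply: epts_var].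
- by exists (vz w t).
- by exists (vs t v).
Qed.

Lemma epts_finite w (e : env X w) : finite_set (epts e).
Proof.
elim: w e => [|t w IHw] e; first by rewrite epts_nil.
by rewrite (env_consE e) epts_cons finite_setU; split; [apply: finite_set1|].
Qed.

Lemma epts_enum (B : set {s & X s}) : finite_set B ->
  exists w (e : env X w), epts e = B.
Proof.
elim/finite_set_ind => [|[s x] {}B [w [e <-]]].
  by exists [::], (enil X); rewrite epts_nil.
by exists (s :: w), (econs x e); rewrite epts_cons.
Qed.

(** A tuple is a head from the fibre of [B] over [t] and a shorter tuple; the fibre is finite
    because [existT _ t] is injective. *)
Lemma finite_env (B : set {s & X s}) w : finite_set B ->
  finite_set [set e : env X w | epts e `<=` B].
Proof.
move=> Bfin; elim: w => [|t w IHw].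
  apply: (@sub_finite_set _ _ [set enil X]); last exact: finite_set1.
  by move=> e _; rewrite /= (env_nilE e).
have Bt : finite_set [set x : X t | B (existT _ t x)].
  rewrite -[X in finite_set X]/(existT X t @^-1` B).
  by apply: finite_preimage => // x y _ _; apply: existT_injr.
apply: sub_finite_set (finite_image2 (fun x e => @econs _ _ t x w e) Bt IHw).
move=> e eB; exists (e t (vz w t)); first exact/eB/epts_var.
exists (fun s v => e s (vs t v)); last by rewrite -env_consE.
by move=> x [v ev]; apply: eB; exists (vs t v).
Qed.

End Environments.

(** * First-order definable sets: change of variables, Boolean operations, invariance *)

Section Renaming.
Variable M : structure.
Implicit Type w : seq (sorts M).

Definition renaming w w' := forall s, var w s -> var w' s.

(** A renaming is an environment whose values are variables, so passing under a quantifier is again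
    an [econs]. *)
Definition ren_lift w w' t (r : renaming w w') : renaming (t :: w) (t :: w') :=
  @econs _ (var (t :: w')) t (vz w' t) w (fun s v => vs t (r s v)).

Fixpoint ren_term w w' (r : renaming w w') s (t : term w s) : term w' s :=
  match t with
  | tvar s v => tvar (r s v)
  | tapp f a => tapp (fun s v => ren_term r (a s v))
  end.

Fixpoint ren w (p : formula w) w' : renaming w w' -> formula w' :=
  match p in formula w return renaming w w' -> formula w' with
  | fbot _ => fun r => fbot w'
  | feq _ _ t u => fun r => feq (ren_term r t) (ren_term r u)
  | Defs.frel _ R a => fun r => Defs.frel (fun s v => ren_term r (a s v))
  | fimp _ p q => fun r => fimp (ren p r) (ren q r)
  | fall _ s p => fun r => fall (ren p (ren_lift (t:=s) r))
  end.

Lemma eval_ren w w' (r : renaming w w') (e : env (@carrier M) w') s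
    (t : term w s) :
  eval e (ren_term r t) = eval (fun s v => e s (r s v)) t.
Proof.
by elim: t => //= f a IHa; congr op_in; apply: env_eq => u v; apply: IHa.
Qed.

Lemma sat_ren w (p : formula w) w' (r : renaming w w')
    (e : env (@carrier M) w') :
  sat (ren p r) e <-> sat p (fun s v => e s (r s v)).
Proof.
elim: p w' r e => {w} [w|w s t u|w R a|w p IHp q IHq|w s p IHp] w' r e //=.
- by rewrite !eval_ren.
- suff -> : (fun s v => eval e (ren_term r (a s v))) =
      (fun s v => eval (fun s v => e s (r s v)) (a s v)) by [].
  by apply: env_eq => s v; apply: eval_ren.
- by rewrite IHp IHq.
- suff E x : (fun t v => econs x e (ren_lift (t:=s) r v)) =
      econs x (fun t v => e t (r t v)).
    by split=> pe x; have := pe x; rewrite IHp E.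
  by apply: env_eq; apply: var_cons_ind.
Qed.

Lemma fo_ren w w' (r : renaming w w') (D : set (env (@carrier M) w)) :
  fo_definable D -> fo_definable [set e | D (fun s v => e s (r s v))].
Proof.
by case=> p ->; exists (ren p r); apply/seteqP; split=> e /sat_ren.
Qed.

Lemma fo_setC w (D : set (env (@carrier M) w)) :
  fo_definable D -> fo_definable (~` D).
Proof. by case=> p ->; exists (fimp p (fbot w)). Qed.

Lemma fo_setT w : fo_definable [set: env (@carrier M) w].
Proof. by exists (fimp (fbot w) (fbot w)); apply/seteqP; split=> e _ /=. Qed.

Lemma fo_setI w (D E : set (env (@carrier M) w)) :
  fo_definable D -> fo_definable E -> fo_definable (D `&` E).
Proof.
case=> p -> [q ->]; exists (fimp (fimp p (fimp q (fbot w))) (fbot w)).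
apply/seteqP; split=> e /=; first by case=> pe qe /(_ pe); apply.
by move=> pqe; split; apply: contrapT => n; apply: pqe => // pe.
Qed.

Lemma fo_setU w (D E : set (env (@carrier M) w)) :
  fo_definable D -> fo_definable E -> fo_definable (D `|` E).
Proof.
move=> Dfo Efo; rewrite -[_ `|` _]setCK setCU.
by apply/fo_setC/fo_setI; apply/fo_setC.
Qed.

Lemma fo_ex s w (D : set (env (@carrier M) (s :: w))) :
  fo_definable D -> fo_definable [set e | exists x, D (econs x e)].
Proof.
move=> /fo_setC[p pD]; exists (fimp (fall p) (fbot w)).
apply/seteqP; split=> e /=; rewrite -pD /setC /=; last first.
  by move=> nD; apply: contrapT => nE; apply: nD => x Dx; apply: nE; exists x.
by case=> x Dx /(_ x).
Qed.

Lemma fo_bigcap (I : Type) (F : set I) w (D : I -> set (env (@carrier M) w)) :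
  finite_set F -> (forall i, F i -> fo_definable (D i)) ->
  fo_definable (\bigcap_(i in F) D i).
Proof.
elim/finite_set_ind => [|i {}F IHF] Dfo; first by rewrite bigcap_set0; apply: fo_setT.
rewrite bigcap_setU1; apply: fo_setI; first by apply: Dfo; left.
by apply: IHF => j Fj; apply: Dfo; right.
Qed.

Lemma fo_bigcup (I : Type) (F : set I) w (D : I -> set (env (@carrier M) w)) :
  finite_set F -> (forall i, F i -> fo_definable (D i)) ->
  fo_definable (\bigcup_(i in F) D i).
Proof.
move=> Ffin Dfo; rewrite -[\bigcup_(_ in _) _]setCK setC_bigcup.
by apply/fo_setC/fo_bigcap => // i Fi; apply/fo_setC/Dfo.
Qed.

Lemma sat_aut (a : aut M) w (p : formula w) e :
  sat p (emap (aut_fun a) e) <-> sat p e.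
Proof.
have evalE w' (e' : env (@carrier M) w') s (t : term w' s) :
    eval (emap (aut_fun a) e') t = aut_fun a (eval e' t).
  elim: t => //= f u IHu; rewrite aut_op; congr op_in.
  by apply: env_eq => ? ?; apply: IHu.
elim: p e => {w} [w|w s t u|w R u|w p IHp q IHq|w s p IHp] e //=.
- by rewrite !evalE; split=> [/(can_inj (@aut_funK M a s))|->].
- rewrite -[X in _ <-> X](aut_rel a).
  suff -> : (fun s v => eval (emap (aut_fun a) e) (u s v)) =
      emap (aut_fun a) (fun s v => eval e (u s v)) by [].
  by apply: env_eq => s v; apply: evalE.
- by rewrite IHp IHq.
- split=> pe x; first by apply/IHp; rewrite emap_cons.
  by rewrite -(aut_invK a x) -emap_cons; apply/IHp.
Qed.

Lemma fo_definable_invariant w (D : set (env (@carrier M) w)) :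
  fo_definable D -> definable D.
Proof. by case=> p -> a e; apply: sat_aut. Qed.

End Renaming.

(** * Homogeneity of structures covered by finite 0-definable sets *)

Section Homogeneity.
Variable M : structure.

Definition finite_definable (B : set (pts M)) : Prop :=
  finite_set B /\ forall s,
    fo_definable [set e : env (@carrier M) [:: s] | B (existT _ s (e s (vz _ _)))].

(** Phrased with sets rather than substructures, so that the pieces are stable under finite
    unions. *)
Definition locally_finite : Prop :=
  forall x : pts M, exists2 B, finite_definable B & B x.

Lemma finitary_locally_finite : finitary M -> locally_finite.
Proof.
case=> I [P [Pfin _ Pfo Pcover]] [s x].
have [i Pix] := Pcover s x.
by exists [set x : pts M | P i (tag x) (tagged x)] => //; split=> // t; apply: Pfo.
Qed.

Lemma finite_definable_cover (F : set (pts M)) : locally_finite -> finite_set F ->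
  exists2 B, finite_definable B & F `<=` B.
Proof.
move=> Mfin; elim/finite_set_ind => [|x {}F [B [Bfin Bfo] FB]].
  exists set0 => //; split=> // s; have := fo_setC (fo_setT (M := M) [:: s]).
  by rewrite setCT.
have [C [Cfin Cfo] Cx] := Mfin x; exists (C `|` B).
  by split; [rewrite finite_setU|move=> s; apply: fo_setU].
by move=> y [->|/FB]; [left|right].
Qed.

Lemma finite_definable_aut (B : set (pts M)) (a : aut M) s (x : carrier s) :
  finite_definable B -> B (existT _ s (aut_fun a x)) <-> B (existT _ s x).
Proof. by case=> _ Bfo; have := fo_definable_invariant (Bfo s) a (env1 x). Qed.

Lemma fo_epts (B : set (pts M)) w : finite_definable B ->
  fo_definable [set e : env (@carrier M) w | epts e `<=` B].
Proof.
case=> _ Bfo; elim: w => [|t w IHw].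
  rewrite (_ : [set _ | _] = setT); first exact: fo_setT.
  by apply/seteqP; split=> // e _; rewrite /= epts_nil.
pose r0 : renaming [:: t] (t :: w) := @econs _ (var (t :: w)) t (vz w t) _ (enil _).
pose r1 : renaming w (t :: w) := fun s v => vs t v.
have := fo_setI (fo_ren r0 (Bfo t)) (fo_ren r1 IHw).
congr fo_definable; apply/seteqP; split=> e /=;
  rewrite [in epts e](env_consE e) epts_cons /r1.
  by case=> Be0 Be x [->//|]; apply: Be.
by move=> Be; split=> [|x ex]; apply: Be; [left|right].
Qed.

(* A partial elementary map, given by its graph. *)
Definition elementary (R : set {s & (@carrier M s * @carrier M s)%type}) : Prop :=
  forall w (D : set (env (@carrier M) w)) e e', fo_definable D ->
    (forall s v, R (existT _ s (e s v, e' s v))) -> D e -> D e'.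

Definition converse (R : set {s & (@carrier M s * @carrier M s)%type}) :
    set {s & (@carrier M s * @carrier M s)%type} :=
  [set z | R (existT _ (tag z) ((tagged z).2, (tagged z).1))].

(** Definable sets are closed under complement, so preserving them also reflects them. *)
Lemma elementary_converse R : elementary R -> elementary (converse R).
Proof.
move=> Rel w D e e' Dfo ee' De; apply: contrapT => nDe'.
exact: (Rel _ (~` D) e' e (fo_setC Dfo) ee').
Qed.

(** All occurrences of the new pair are gathered into one head variable. A definable set evaluated
    at [e] thus becomes a definable relation between [x] and a tuple from the domain of [R]. *)
Lemma split_env R s (x y : carrier s) w (e e' : env (@carrier M) w) :
  (forall t v, (existT _ s (x, y) |` R) (existT _ t (e t v, e' t v))) ->
  exists w1 (d d' : env (@carrier M) w1) (r : renaming w (s :: w1)),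
  [/\ forall t v, R (existT _ t (d t v, d' t v)),
      e = (fun t v => econs x d (r t v))
    & e' = (fun t v => econs y d' (r t v))].
Proof.
elim: w e e' => [|u w IHw] e e' Ree'.
  exists [::], (enil _), (enil _), (fun t v => False_rect _ (var_nil v)).
  split; first by move=> t v; case: (var_nil v).
  - by apply: env_eq => t v; case: (var_nil v).
  - by apply: env_eq => t v; case: (var_nil v).
have [w1 [d [d' [r [Rdd' ed e'd']]]]] := IHw (fun t v => e t (vs u v))
  (fun t v => e' t (vs u v)) (fun t v => Ree' t (vs u v)).
rewrite (env_consE e) (env_consE e') ed e'd' => {ed e'd'}.
have := Ree' u (vz w u); move: (e u _) (e' u _) => e0 e0' {e e' Ree'} [E|Re0].
  move: (existT_inj1 E) => us; subst u.
  have [-> ->] := existT_injr E.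
  exists w1, d, d', (@econs _ (var (s :: w1)) s (vz w1 s) w r).
  by split=> //; apply: env_eq; apply: var_cons_ind.
(* The new pair from [R] is inserted just below the head variable reserved for [x]; [j] moves the
   earlier variables past it. *)
pose j : renaming (s :: w1) (s :: u :: w1) := ren_lift (t := s) (fun t v => vs u v).
exists (u :: w1), (econs e0 d), (econs e0' d'),
  (@econs _ (var (s :: u :: w1)) u (vs s (vz w1 u)) w (fun t v => j t (r t v))).
have jE (z : carrier s) (z0 : carrier u) c t (v : var (s :: w1) t) :
    econs z (econs z0 c) (j t v) = econs z c v.
  by move: t v; apply: var_cons_ind.
split; first by apply: var_cons_ind.
- by apply: env_eq; apply: var_cons_ind => //= t v; rewrite jE.
- by apply: env_eq; apply: var_cons_ind => //= t v; rewrite jE.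
Qed.

(** Only the finitely many elements of a 0-definable [B] containing [x] need be tried as [y]. If
    each is ruled out by some formula, the conjunction of these formulas is satisfied by [x] in [B]
    over the domain of [R], but by nothing in [B] over its image. *)
Lemma elementary_extend R s (x : carrier s) : locally_finite -> elementary R ->
  exists y, elementary (existT _ s (x, y) |` R).
Proof.
move=> Mfin Rel; apply: contrapT => noy.
have [B [Bfin Bfo] Bx] := Mfin (existT _ s x).
(* Induction on [Y] collects the refutations of all its elements into a single [D] over a single
   tuple of parameters. *)
have sep (Y : set (pts M)) : finite_set Y -> exists w (e e' : env (@carrier M) w)
    (D : set (env (@carrier M) (s :: w))),
    [/\ forall t v, R (existT _ t (e t v, e' t v)), fo_definable D,
        D (econs x e) & forall y, Y (existT _ s y) -> ~ D (econs y e')].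
  elim/finite_set_ind => [|z {}Y [w [e [e' [D [Ree' Dfo Dx nDY]]]]]].
    exists [::], (enil _), (enil _), setT; split=> //; last exact: fo_setT.
    by move=> t v; case: (var_nil v).
  have [[y zy]|nz] := pselect (exists y : carrier s, z = existT _ s y); last first.
    exists w, e, e', D; split=> // y [yz|]; last exact: nDY.
    by case: nz; exists y.
  have [w' [E [d [d' [Efo Rdd' Ed nEd']]]]] :
      exists w (E : set (env (@carrier M) w)) d d',
      [/\ fo_definable E,
          forall t v, (existT _ s (x, y) |` R) (existT _ t (d t v, d' t v)),
          E d & ~ E d'].
    apply: contrapT => nE; apply: noy; exists y => w' E d d' Efo Rdd' Ed.
    by apply: contrapT => nEd'; apply: nE; exists w', E, d, d'.
  have [w1 [c [c' [r [Rcc' dE d'E]]]]] := split_env Rdd'.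
  (* The two parameter tuples are concatenated, while the head variable stays shared by [D] and
     [E]. *)
  pose rl : renaming (s :: w) (s :: (w ++ w1)) := ren_lift (t := s) (@var_l _ w w1).
  pose rr : renaming w' (s :: (w ++ w1)) :=
    fun t v => ren_lift (t := s) (@var_r _ w w1) (r t v).
  have lE (z' : carrier s) u u' :
      (fun t v => econs z' (ecat u u') (rl t v)) = econs z' u.
    by apply: env_eq; apply: var_cons_ind => //= t v; apply: ecat_l.
  have rE (z' : carrier s) u u' : (fun t v => econs z' (ecat u u') (rr t v)) =
      (fun t v => econs z' u' (r t v)).
    apply: env_eq => t v; rewrite /rr; move: (r t v) => {}v; move: t v.
    by apply: var_cons_ind => //= t v; apply: ecat_r.
  exists (w ++ w1), (ecat e c), (ecat e' c').
  exists ([set u | D (fun t v => u t (rl t v))] `&`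
          [set u | E (fun t v => u t (rr t v))]).
  split.
  - by apply: var_cat_ind => t v; rewrite ?ecat_l ?ecat_r.
  - by apply: fo_setI; apply: fo_ren.
  - by split; rewrite /= ?lE ?rE -?dE.
  - move=> y' [y'z|Yy'] []; rewrite /= lE rE => Dy' Ey'; last exact: (nDY y').
    by rewrite zy in y'z; apply: nEd'; rewrite d'E -(existT_injr y'z).
have [w [e [e' [D [Ree' Dfo Dx nDB]]]]] := sep _ Bfin.
(* That some element of [B] satisfies [D] over the parameters is first-order, so it transfers from
   [e] to [e']. *)
pose r0 : renaming [:: s] (s :: w) := @econs _ (var (s :: w)) s (vz w s) _ (enil _).
have /fo_ex/Rel/(_ Ree')[|y [By Dy]] := fo_setI (fo_ren r0 (Bfo s)) Dfo.
  by exists x.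
exact: (nDB y).
Qed.

(** A maximal elementary extension is total by one-point extension, and onto by one-point extension
    of its converse. *)
Lemma elementary_aut R : locally_finite -> elementary R ->
  exists a : aut M, forall s x y, R (existT _ s (x, y)) -> aut_fun a x = y.
Proof.
move=> Mfin Rel.
(* Zorn's lemma is applied to the part [S] adjoined to [R], so that the empty chain, whose union is
   empty, causes no trouble. *)
have [F FP tF|S [Sel Smax]] := @Zorn_bigcup _ (fun S => elementary (S `|` R)).
  move=> w D e e' Dfo FRee'.
  (* A tuple has finitely many entries, so its pairs all lie in [R], or else in one member of the
     chain together with [R]. *)
  have [Ree'|[S FS See']] : (forall s v, R (existT _ s (e s v, e' s v))) \/
      exists2 S, F S & forall s v, (S `|` R) (existT _ s (e s v, e' s v)).
  - elim: w e e' {D Dfo} FRee' => [|t w IHw] e e' FRee'.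
      by left=> s v; case: (var_nil v).
    have [Ree'|[S FS Se]] := IHw _ _ (fun s v => FRee' s (vs t v)).
    + have [[S FS Se0]|Re0] := FRee' t (vz w t).
        by right; exists S => //; apply: var_cons_ind => [|s v]; [left|right].
      by left; apply: var_cons_ind.
    + have [[T FT Te0]|Re0] := FRee' t (vz w t); last first.
        by right; exists S => //; apply: var_cons_ind => [|s v]; [right|].
      right; have [ST|TS] := tF _ _ FS FT.
      * exists T => //; apply: var_cons_ind => [|s v]; first by left.
        by case: (Se s v) => [/ST|]; [left|right].
      * by exists S => //; apply: var_cons_ind => [|s v //]; left; apply: TS.
  - exact: (Rel).
  - exact: (FP S).
pose T := S `|` R.
have Tmax z : elementary (z |` T) -> T z.
  rewrite /T setUA => zel; apply: contrapT => nTz; apply: Smax zel.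
  split; first exact: subsetUr.
  by move=> /(_ z) Sz; apply: nTz; left; apply: Sz; left.
have Tl s (x : carrier s) : exists y, T (existT _ s (x, y)).
  by have [y /Tmax] := elementary_extend x Mfin Sel; exists y.
have Tr s (y : carrier s) : exists x, T (existT _ s (x, y)).
  have [x /elementary_converse xel] :=
    elementary_extend y Mfin (elementary_converse Sel).
  exists x; apply: Tmax; move: xel; congr elementary.
  apply/seteqP; split=> -[t [u v]] [E|]; [left| by right|left|by right].
    move: (existT_inj1 E) => /= ts; subst t.
    by have [-> ->] := existT_injr E.
  move: (existT_inj1 E) => /= ts; subst t.
  by have [-> ->] := existT_injr E.
(* Equality is first-order: preserving it makes [T] functional, and reflecting it makes [T]
   injective. *)
have eq_fo s : fo_definable
    [set e : env (@carrier M) [:: s; s] | e s (vz _ _) = e s (vs _ (vz _ _))].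
  by exists (feq (tvar (vz _ _)) (tvar (vs _ (vz _ _)))).
have Tfun s (x y y' : carrier s) :
    T (existT _ s (x, y)) -> T (existT _ s (x, y')) -> y = y'.
  move=> Txy Txy'.
  apply: (Sel _ _ (econs x (env1 x)) (econs y (env1 y')) (eq_fo s)) => //.
  apply: var_cons_ind => //; apply: var_cons_ind => // t v; by case: (var_nil v).
have Tinj s (x x' y : carrier s) :
    T (existT _ s (x, y)) -> T (existT _ s (x', y)) -> x = x'.
  move=> Txy Txy'.
  apply: (elementary_converse Sel (eq_fo s)
    (e := econs y (env1 y)) (e' := econs x (env1 x'))) => //.
  apply: var_cons_ind => //; apply: var_cons_ind => // t v; by case: (var_nil v).
pose F s (x : carrier s) := sval (cid (Tl s x)).
pose G s (y : carrier s) := sval (cid (Tr s y)).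
have TF s (x : carrier s) : T (existT _ s (x, F s x)) := svalP (cid (Tl s x)).
have TG s (y : carrier s) : T (existT _ s (G s y, y)) := svalP (cid (Tr s y)).
have FK s : cancel (F s) (G s) by move=> x; apply: Tinj (TG _ _) (TF _ _).
have GK s : cancel (G s) (F s) by move=> x; apply: Tfun (TF _ _) (TG _ _).
(* Basic relations and graphs of operations are first-order as well, so the bijection is an
   automorphism. *)
have Frel (r : rels M) e : rel_in (r := r) (emap F e) <-> rel_in e.
  have rfo : fo_definable (rel_in (s := M) (r := r)).
    by exists (Defs.frel (fun s v => tvar v)).
  split; last by apply: (Sel _ _ _ _ rfo) => s v; apply: TF.
  by apply: (elementary_converse Sel rfo) => s v; apply: TF.
have Fop (o : ops M) e : F _ (op_in (f := o) e) = op_in (emap F e).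
  have ofo : fo_definable [set e : env (@carrier M) (op_cod o :: op_dom o) |
      e _ (vz _ _) = op_in (fun s v => e s (vs _ v))].
    by exists (feq (tvar (vz _ _)) (tapp (fun s v => tvar (vs _ v)))).
  apply: (Sel _ _ (econs (op_in e) e) (econs (F _ (op_in e)) (emap F e)) ofo) => //.
  by apply: var_cons_ind => [|s v]; apply: TF.
exists (Aut FK GK Frel Fop) => s x y Rxy /=.
by apply: Tfun (TF _ _) _; right.
Qed.

(** Only finitely many tuples lie in [B]. If no formula separated a tuple in [D] from one outside,
    sending the first to the second would extend to an automorphism, against invariance. *)
Lemma fo_invariant (B : set (pts M)) w (D : set (env (@carrier M) w)) :
  locally_finite -> finite_definable B -> definable D ->
  (forall e, D e -> epts e `<=` B) -> fo_definable D.
Proof.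
move=> Mfin Bfd Dinv DB; pose Z := [set e : env (@carrier M) w | epts e `<=` B].
have Zfin : finite_set Z by apply: finite_env; case: Bfd.
have Zfo : fo_definable Z := fo_epts w Bfd.
(* The existential stands outside the implications so that [choice] applies to all pairs; [setT] is
   the default for pairs with nothing to separate. *)
have sep e e' : exists E, D e -> ~ D e' -> [/\ fo_definable E, E e & ~ E e'].
  apply: contrapT => nE.
  have [De nDe'] : D e /\ ~ D e'.
    by split; apply: contrapT => n; apply: nE; exists setT => // /n.
  pose R := [set z | exists s (v : var w s), z = existT _ s (e s v, e' s v)].
  have Rel : elementary R.
    move=> u E d d' Efo Rdd' Ed; apply: contrapT => nEd'.
    (* Tuples of pairs in [R] are drawn from [e] and [e'] by a common renaming, so a set that [R]
       fails to preserve pulls back to one separating [e] from [e']. *)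
    have [r rE] : exists r : renaming u w,
        d = (fun s v => e s (r s v)) /\ d' = (fun s v => e' s (r s v)).
      have rex s (v : var u s) : exists v' : var w s,
          e s v' = d s v /\ e' s v' = d' s v.
        have [t [v' E']] := Rdd' s v; move: (existT_inj1 E') => ts; subst t.
        by have [-> ->] := existT_injr E'; exists v'.
      exists (fun s v => sval (cid (rex s v))).
      by split; apply: env_eq => s v; case: (cid (rex s v)) => v' [].
    case: rE => dE d'E; apply: nE; exists [set c | E (fun s v => c s (r s v))] => _ _.
    by split; rewrite /= -?dE -?d'E //; apply: fo_ren.
  have [a aR] := elementary_aut Mfin Rel; apply: nDe'.
  suff -> : e' = emap (aut_fun a) e by apply/Dinv.
  by apply: env_eq => s v; rewrite /emap (aR s (e s v) (e' s v)) //; exists s, v.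
have [E EP] := choice (fun z : env (@carrier M) w * env (@carrier M) w => sep z.1 z.2).
have -> : D = \bigcup_(e in Z `&` D)
    (Z `&` \bigcap_(e' in Z `&` ~` D) E (e, e')).
  apply/seteqP; split=> [e De|e [d [Zd Dd] [Ze]]].
    exists e; split=> //; [exact: DB|exact: DB|].
    by move=> e' [_ nDe']; have [] := EP (e, e') De nDe'.
  move=> Ede; apply: contrapT => nDe.
  by have [_ _] := EP (d, e) Dd nDe; apply; apply: Ede.
apply: fo_bigcup => [|e [_ De]]; first exact: sub_finite_set Zfin.
apply: fo_setI => //; apply: fo_bigcap => [|e' [_ nDe']].
  exact: sub_finite_set Zfin.
by have [] := EP (e, e') De nDe'.
Qed.

End Homogeneity.

(** * Pointwise convergence and compactness in Aut(M) *)

Section AutomorphismTopology.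
Variable M : structure.
Implicit Types (a b : aut M) (F : set (pts M)).

Definition agree F a b : Prop :=
  forall x, F x -> aut_fun a (tagged x) = aut_fun b (tagged x).

Lemma agree_emap w (e : env (@carrier M) w) a b :
  agree (epts e) a b <-> emap (aut_fun a) e = emap (aut_fun b) e.
Proof.
split=> [ab|ab [s x] [v <-]].
  by apply: env_eq => s v; apply: (ab (existT _ s (e s v))); apply: epts_var.
exact: (congr1 (fun u : env _ _ => u _ v) ab).
Qed.

Lemma agree_emap_sub w w' (m : env (@carrier M) w) (e : env (@carrier M) w') a b :
  epts e `<=` epts m -> emap (aut_fun a) m = emap (aut_fun b) m ->
  emap (aut_fun a) e = emap (aut_fun b) e.
Proof. by move=> em /agree_emap ab; apply/agree_emap => x /em /ab. Qed.

Lemma act_class a (S : EqSort M) (C : El S) e :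
  dom S e -> sval C = [set e' | dom S e' /\ eqv S e e'] ->
  sval (act a C) = [set e' | dom S e' /\ eqv S (emap (aut_fun a) e) e'].
Proof.
move=> De CE; rewrite /= CE; apply/seteqP; split=> e' /= [].
  move=> /(dom_definable S a) + /(eqv_definable S a).
  by rewrite (emapK (@aut_invK M a)).
by rewrite -{1 2}(emapK (@aut_invK M a) e') dom_definable eqv_definable.
Qed.

(** A class moves with any representative, which is a finite tuple; hence the action on each
    imaginary is continuous. *)
Lemma act_local (S : EqSort M) (C : El S) :
  exists2 F, finite_set F & forall a b, agree F a b -> act a C = act b C.
Proof.
have [e De CE] := svalP C; exists (epts e); first exact: epts_finite.
by move=> a b /agree_emap ab; apply: act_eq; rewrite !(act_class _ De CE) ab.
Qed.

Lemma actE_fix a (X : MEq M) : actE a X = X <-> act a (tagged X) = tagged X.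
Proof.
case: X => S C; split=> [|E]; first exact: existT_injr.
exact: (congr1 (existT _ S) E).
Qed.

Lemma home_fix a (x : pts M) :
  actE a (home M x) = home M x <-> aut_fun a (tagged x) = tagged x.
Proof.
case: x => s x; rewrite actE_fix /=; split=> [E|E].
  have : sval (act a (home_el x)) (emap (aut_fun a) (env1 x)).
    by rewrite /= (emapK (@aut_funK M a)).
  by rewrite E /= => /(congr1 (fun e : env _ _ => e s (vz _ _))).
apply: act_eq; rewrite /=; have E1 : emap (aut_fun a) (env1 x) = env1 x.
  by rewrite /env1 emap_cons E; congr econs; apply: env_nilE.
apply/seteqP; split=> e /= [ex]; last by rewrite ex -{1}E1 (emapK (@aut_funK M a)).
by rewrite -E1 -ex (emapK (@aut_invK M a)).
Qed.

Lemma home_first_order (x : pts M) : eq_part M (home M x).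
Proof.
split=> /=; first exact: fo_setT.
exists (feq (tvar (vz [:: tag x] (tag x))) (tvar (vs (tag x) (vz [::] (tag x))))).
apply/seteqP; split=> e /= [E].
  exact: (congr1 (fun e : env _ _ => e _ (vz _ _)) E).
apply: env_eq; apply: var_cons_ind => // s v; by case: (var_nil v).
Qed.

Lemma ultra_finite (T V : Type) (U : set_system T) (f : T -> V) (B : set V) :
  UltraFilter U -> finite_set B -> (forall t, B (f t)) ->
  exists v, U [set t | f t = v].
Proof.
move=> Uultra Bfin fB.
have : U (f @^-1` B) by apply: filterS (@filterT _ U _) => t _; apply: fB.
elim/finite_set_ind: Bfin {fB} => [U0|v {}B IHB UvB].
  by case: (@filter_not_empty _ U _); apply: filterS U0.
have [Uv|Unv] := in_ultra_setVsetC [set t | f t = v] Uultra; first by exists v.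
by apply: IHB; apply: filterS (filterI UvB Unv) => t /= [[]].
Qed.

(** Closedness for pointwise convergence: agreement with [w] on finite sets gives the basic
    neighbourhoods of [w]. *)
Definition aut_closed (C : set (aut M)) : Prop :=
  forall w, (forall F, finite_set F -> exists2 a, C a & agree F a w) -> C w.

Lemma aut_closedI (C D : set (aut M)) :
  aut_closed C -> aut_closed D -> aut_closed (C `&` D).
Proof.
by move=> Ccl Dcl w CD; split; [apply: Ccl|apply: Dcl] => F /CD[a [Ca Da] aw];
  exists a.
Qed.

Lemma stab_closed (A : set (MEq M)) : aut_closed (stab A).
Proof.
move=> w Aw X AX; apply/actE_fix; have [F Ffin loc] := act_local (tagged X).
by have [a Aa /loc <-] := Aw F Ffin; apply/actE_fix/Aa.
Qed.

Lemma moving_closed s (x : carrier s) : aut_closed [set a | aut_fun a x <> x].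
Proof.
by move=> w /(_ _ (finite_set1 (existT _ s x)))[a /= ax /(_ _ erefl) /= <-].
Qed.

(* Every orbit on points is finite, so that automorphisms and their inverses
   have pointwise limits along an ultrafilter. *)
Lemma aut_compact (I : Type) (K : set (aut M)) (C : I -> set (aut M)) :
  locally_finite M -> aut_closed K -> (forall i, aut_closed (C i)) ->
  (forall D : set I, finite_set D -> exists a, K a /\ forall i, D i -> C i a) ->
  exists a, K a /\ forall i, C i a.
Proof.
move=> Mfin Kclosed Cclosed fip.
(* Each generator is cut down to [K], so that [K] belongs to the filter even when [I] is empty. *)
pose G := filter_from (@finite_set I) (fun D => K `&` \bigcap_(i in D) C i).
have Gproper : ProperFilter G.
  apply: filter_from_proper => [|D Dfin]; last by have [a] := fip D Dfin; exists a.
  apply: filter_from_filter; first by exists set0.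
  move=> D E Dfin Efin; exists (D `|` E); first by rewrite finite_setU.
  by rewrite bigcap_setU setIACA setIid.
have [U [Uultra GU]] := ultraFilterLemma Gproper.
(* Values stay in the finite invariant set [B]. The map [f] will be the identity and then inversion,
   the latter giving the inverse of the limit. *)
have lim s (x : carrier s) (f : aut M -> aut M) :
    exists y, U [set a | aut_fun (f a) x = y].
  have [B Bfd Bx] := Mfin (existT _ s x).
  apply: (@ultra_finite _ _ U (fun a => aut_fun (f a) x)
    (existT (@carrier M) s @^-1` B)) => //.
    apply: finite_preimage; last by case: Bfd.
    by move=> y z _ _; apply: existT_injr.
  by move=> a; apply/finite_definable_aut.
pose f s (x : carrier s) := sval (cid (lim s x id)).
pose g s (x : carrier s) := sval (cid (lim s x (fun a => a^-1%g))).
have Uf s (x : carrier s) : U [set a | aut_fun a x = f s x] := svalP (cid (lim s x id)).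
have Ug s (x : carrier s) : U [set a | aut_inv a x = g s x] :=
  svalP (cid (lim s x (fun a => a^-1%g))).
have UF F : finite_set F ->
    U [set a | forall x, F x -> aut_fun a (tagged x) = f _ (tagged x)].
  elim/finite_set_ind => [|x {}F IHF].
    by apply: filterS (@filterT _ U _) => a _ x [].
  by apply: filterS (filterI (Uf _ (tagged x)) IHF) => a [ax aF] y [->|/aF].
have UI A B : U A -> U B -> exists a, A a /\ B a.
  by move=> UA UB; exact: (filter_ex (filterI UA UB)).
(* On any single tuple the limit agrees with a genuine automorphism, from which it inherits
   compatibility with relations and operations. *)
have Ue w (e : env (@carrier M) w) : exists a, emap (aut_fun a) e = emap f e.
  have /filter_ex[a aE] := UF _ (epts_finite e); exists a.
  by apply: env_eq => s v; apply: (aE (existT _ s (e s v))); apply: epts_var.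
have fK s : cancel (f s) (g s).
  move=> x; have [a [<- <-]] := UI _ _ (Uf _ x) (Ug _ (f s x)).
  exact: aut_funK.
have gK s : cancel (g s) (f s).
  move=> x; have [a [<- <-]] := UI _ _ (Ug _ x) (Uf _ (g s x)).
  exact: aut_invK.
have frel (r : rels M) e : rel_in (r := r) (emap f e) <-> rel_in e.
  by have [a <-] := Ue _ e; apply: aut_rel.
have fop (o : ops M) e : f _ (op_in (f := o) e) = op_in (emap f e).
  have [a aE] := Ue _ (econs (op_in e) e); rewrite !emap_cons in aE.
  have <- : aut_fun a (op_in e) = f _ (op_in e).
    exact: (congr1 (fun u : env _ _ => u _ (vz _ _)) aE).
  have -> : emap f e = emap (aut_fun a) e.
    apply: env_eq => s v; apply: esym.
    exact: (congr1 (fun u : env _ _ => u _ (vs _ v)) aE).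
  exact: aut_op.
have Ucl E : U E -> aut_closed E -> E (Aut fK gK frel fop).
  by move=> UE; apply=> F /UF/(UI _ _ UE)[a [Ea aF]]; exists a.
exists (Aut fK gK frel fop); split=> [|i]; apply: Ucl => //; apply: GU.
  by exists set0 => // a [].
by exists [set i]; [apply: finite_set1|rewrite bigcap_set1 => a []].
Qed.

Definition fixed_imaginaries (H : set (aut M)) : set (MEq M) :=
  eq_part M `&` [set X | forall b, H b -> actE b X = X].

(** * The orbit of a tuple under a subgroup as a first-order imaginary *)

Section OrbitImaginary.
Variables (H : set (aut M)) (B : set (pts M)) (w : seq (sorts M)).
Variable m : env (@carrier M) w.
Hypotheses (H1 : H 1%g) (HM : forall a b, H a -> H b -> H (a * b)%g)
  (HV : forall a, H a -> H a^-1%g) (Bfd : finite_definable B) (mB : epts m = B).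

Lemma epts_orbit a : epts (emap (aut_fun a) m) = epts m.
Proof.
have sub b : epts (emap (aut_fun b) m) `<=` epts m.
  move=> [s x] [/= v <-]; rewrite mB; apply/finite_definable_aut => //.
  by rewrite -mB; apply: epts_var.
apply/seteqP; split=> // [[s x]] mx; have := mx.
rewrite mB -(finite_definable_aut a^-1%g _ Bfd) -mB => -[v vx].
by exists v; rewrite /emap vx; apply: aut_invK.
Qed.

(* The cosets of [H K] in [aut M], where [K] is the pointwise stabiliser of the
   points of m.  [K] is normal because these points form an invariant set, so
   that [H K] is a group and the cosets are the classes of an equivalence. *)
Definition orbit_sort : EqSort M.
Proof.
apply: (@MkEqSort M w [set e | exists a, e = emap (aut_fun a) m]
  (fun e e' => exists a b, [/\ H b, e = emap (aut_fun a) m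
                            & e' = emap (aut_fun (a * b)%g) m])).
- move=> a e; split=> -[b E]; last by exists (a * b)%g; rewrite E.
  by exists (a^-1 * b)%g; rewrite -(emapK (@aut_funK M a) e) E.
- move=> a e e'; split=> -[b [c [Hc E E']]]; last first.
    by exists (a * b)%g, c; rewrite E E'; split=> //; rewrite -mulgA.
  exists (a^-1 * b)%g, c; split=> //; rewrite -?mulgA.
    by rewrite -(emapK (@aut_funK M a) e) E.
  by rewrite -(emapK (@aut_funK M a) e') E'.
- by move=> e [a ->]; exists a, 1%g; rewrite mulg1.
- move=> e e' _ _ [a [b [Hb -> ->]]]; exists (a * b)%g, b^-1%g.
  by rewrite mulgK; split=> //; apply: HV.
- move=> e e' e'' _ _ _ [a [b [Hb -> E]]] [c [d [Hd E' ->]]].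
  exists a, (b * d)%g; split=> //; first exact: HM.
  rewrite E in E'; rewrite mulgA.
  (* Normality of [K] in use: automorphisms agreeing on [m] agree on all its points, hence on the
     image of [m] under [d]. *)
  have dm : epts (emap (aut_fun d) m) `<=` epts m by rewrite epts_orbit.
  exact: esym (agree_emap_sub dm E').
Defined.

(** This class is exactly the orbit of [m] under [H], since an automorphism fixing [m] fixes every
    tuple with entries among those of [m]. *)
Definition orbit_el : El orbit_sort.
Proof.
exists [set e' | dom orbit_sort e' /\ eqv orbit_sort m e'].
by exists m => //; exists 1%g.
Defined.

Lemma orbit_sort_first_order : locally_finite M -> first_order orbit_sort.
Proof.
move=> Mfin; split.
  apply: (fo_invariant Mfin Bfd); first exact: dom_definable orbit_sort.
  by move=> e [a ->]; rewrite epts_orbit mB.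
apply: (fo_invariant Mfin Bfd).
  by move=> a e; apply: (eqv_definable orbit_sort a).
move=> e [a [b [_ El Er]]] [s x] [/= v <-] {x}; move: s v.
apply: var_cat_ind => s v.
  have -> : e s (var_l w v) = emap (aut_fun a) m v by rewrite -El.
  by rewrite -mB -(epts_orbit a); apply: epts_var.
have -> : e s (var_r w v) = emap (aut_fun (a * b)%g) m v by rewrite -Er.
by rewrite -mB -(epts_orbit (a * b)%g); apply: epts_var.
Qed.

Lemma orbit_el_fixed b : H b -> act b orbit_el = orbit_el.
Proof.
move=> Hb; have dm : dom orbit_sort m by exists 1%g.
have dbm : dom orbit_sort (emap (aut_fun b) m) by exists b.
have mbm : eqv orbit_sort m (emap (aut_fun b) m) by exists 1%g, b; rewrite mul1g.
apply: act_eq; rewrite (act_class (C := orbit_el) b dm erefl).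
apply/seteqP; split=> e [de E]; split=> //.
  exact: (eqv_trans orbit_sort _ _ _ dm dbm de mbm E).
apply: (eqv_trans orbit_sort _ _ _ dbm dm de _ E).
exact: (eqv_sym orbit_sort _ _ dm dbm mbm).
Qed.

Lemma orbit_el_stab a : act a orbit_el = orbit_el ->
  exists2 b, H b & agree B b a.
Proof.
have dm : dom orbit_sort m by exists 1%g.
have dam : dom orbit_sort (emap (aut_fun a) m) by exists a.
move=> E; have : sval (act a orbit_el) (emap (aut_fun a) m).
  rewrite (act_class (C := orbit_el) a dm erefl); split=> //.
  exact: (eqv_refl orbit_sort).
(* Here [c] fixes [m], hence also the image of [m] under [b]; so [c * b] and [b] agree on [m]. *)
rewrite E => -[_ [c [b [Hb mc amE]]]]; exists b => //; rewrite -mB.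
apply/agree_emap; rewrite amE.
have bm : epts (emap (aut_fun b) m) `<=` epts m by rewrite epts_orbit.
exact: (agree_emap_sub (a := 1%g) bm mc).
Qed.

End OrbitImaginary.

(** The orbit of an enumeration of a finite 0-definable set containing [F] is one of the fixed
    imaginaries, and fixing it forces agreement with some element of [H]. *)
Lemma stab_fixed_imaginaries (H : set (aut M)) a F : locally_finite M ->
  H 1%g -> (forall a b, H a -> H b -> H (a * b)%g) -> (forall a, H a -> H a^-1%g) ->
  stab (fixed_imaginaries H) a -> finite_set F -> exists2 b, H b & agree F b a.
Proof.
move=> Mfin H1 HM HV aH Ffin.
have [B Bfd FB] := finite_definable_cover Mfin Ffin.
have [w [m mB]] := epts_enum (proj1 Bfd).
pose X := orbit_el H1 HM HV Bfd mB.
have [|b Hb bB] := orbit_el_stab (a := a) (H1 := H1) (HM := HM) (HV := HV)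
  (Bfd := Bfd) (mB := mB).
  apply: (proj1 (actE_fix a (existT _ _ X))); apply: aH; split.
    exact: orbit_sort_first_order.
  by move=> b Hb; apply/actE_fix/orbit_el_fixed.
by exists b => // x /FB /bB.
Qed.

End AutomorphismTopology.

(** * Homomorphisms, and Aut(M/A) as a stabiliser *)

Lemma multiplicative1 (G H : groupType) (f : {multiplicative G -> H}) :
  f 1%g = 1%g.
Proof. by apply: (mulgI (f 1%g)); rewrite -gmulfM !mulg1. Qed.

Lemma multiplicativeV (G H : groupType) (f : {multiplicative G -> H}) x :
  f x^-1%g = (f x)^-1%g.
Proof. by apply: (mulgI (f x)); rewrite -gmulfM !mulgV multiplicative1. Qed.

Section Stabilisers.
Variables (M : structure) (A : set (MEq M)).

Lemma stab1 : stab A 1%g.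
Proof. by move=> X _; apply/actE_fix/act1. Qed.

Lemma stabM (a b : aut M) : stab A a -> stab A b -> stab A (a * b)%g.
Proof.
move=> Aa Ab X AX; apply/actE_fix; rewrite actM.
by rewrite (proj1 (actE_fix b X) (Ab X AX)); apply/actE_fix/Aa.
Qed.

Lemma stabV (a : aut M) : stab A a -> stab A a^-1%g.
Proof.
move=> Aa X AX; apply/actE_fix.
by rewrite -{1}(proj1 (actE_fix a X) (Aa X AX)) actK.
Qed.

(** Preserving the relation that names a class amounts to fixing the class. With [stab_expansion]
    this identifies Aut(M/A) with [stab A]. *)
Lemma stab_reduct (a : aut (expansion A)) : stab A (reduct a).
Proof.
move=> X AX; apply/actE_fix/act_eq/seteqP; split=> e.
  by move/(@aut_rel _ a (inr (exist _ X AX))); rewrite (emapK (@aut_invK _ a)).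
move=> Xe; apply/(@aut_rel _ a (inr (exist _ X AX))).
by rewrite (emapK (@aut_invK _ a)).
Qed.

Lemma stab_expansion (a : aut M) : stab A a ->
  exists a' : aut (expansion A), reduct a' = a.
Proof.
move=> Aa; have arel (r : rels (expansion A)) e :
    rel_in (s := expansion A) (r := r) (emap (aut_fun a) e) <->
    rel_in (s := expansion A) (r := r) e.
  case: r e => [r|[X AX]] e; first exact: aut_rel.
  have XE := proj1 (actE_fix a X) (Aa X AX).
  by rewrite /= -{1}XE /= (emapK (@aut_funK M a)).
exists (@Aut (expansion A) (@aut_fun M a) (@aut_inv M a) (@aut_funK M a)
  (@aut_invK M a) arel (@aut_op M a)).
exact: aut_eq.
Qed.

End Stabilisers.

(** * The restriction homomorphism and its continuity *)

Section Restriction.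
Variables (N M : structure) (h : interp N M).

Lemma imap_hat (a : aut M) s (x : @carrier N s) :
  imap h (aut_fun (hat h a) x) = act a (imap h x).
Proof. exact: iinvK. Qed.

Lemma hat_local (F : set (pts N)) : finite_set F ->
  exists2 F' : set (pts M), finite_set F' &
    forall a b, agree F' a b -> agree F (hat h a) (hat h b).
Proof.
elim/finite_set_ind => [|x {}F [F' F'fin loc]]; first by exists set0 => // a b _ x [].
have [L Lfin Lloc] := act_local (imap h (tagged x)).
exists (L `|` F'); first by rewrite finite_setU.
move=> a b ab y [->|Fy].
  by rewrite /= (Lloc a b) // => z Lz; apply: ab; left.
by apply: (loc a b _ y Fy) => z F'z; apply: ab; right.
Qed.

Lemma hat_closed (F : set (pts N)) (b : aut N) : finite_set F ->
  aut_closed [set a | agree F (hat h a) b].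
Proof.
move=> Ffin w Fw; have [F' F'fin loc] := hat_local Ffin.
have [a /= ab /loc aw] := Fw F' F'fin => x Fx.
by rewrite -(aw x Fx) ab.
Qed.

Lemma stab_imageP (a : aut M) : stab (range (imapE h)) a <-> hat h a = 1%g.
Proof.
split=> [ha|ha _ [x _ <-]].
  apply: aut_eq => s x /=.
  have /ha/actE_fix /= -> : range (imapE h) (imapE h (existT _ s x)).
    by exists (existT _ s x).
  exact: imapK.
by apply/actE_fix; rewrite /= -imap_hat ha.
Qed.

(** Conjugation by the bijections [imap h] identifies the automorphisms of the image with those of
    [N]. *)
Lemma aut_of_image (c : aut (image_structure h)) : exists b : aut N,
  forall s (x : @carrier N s), imap h (aut_fun b x) = aut_fun c (imap h x).
Proof.
have fK s : cancel (fun x : @carrier N s => Defs.iinv (@aut_fun _ c s (imap h x)))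
    (fun x => Defs.iinv (@aut_inv _ c s (imap h x))).
  by move=> x; rewrite iinvK (@aut_funK _ c) imapK.
have gK s : cancel (fun x : @carrier N s => Defs.iinv (@aut_inv _ c s (imap h x)))
    (fun x => Defs.iinv (@aut_fun _ c s (imap h x))).
  by move=> x; rewrite iinvK (@aut_invK _ c) imapK.
have frel (r : rels N) (e : env (@carrier N) (rel_ar r)) :
    rel_in (s := N) (emap (fun s (x : @carrier N s) =>
      Defs.iinv (@aut_fun _ c s (imap h x))) e) <-> rel_in e.
  rewrite -{2}(emapK (@imapK _ _ h) e).
  exact: (@aut_rel _ c r (emap (@imap _ _ h) e)).
have fop (o : ops N) (e : env (@carrier N) (op_dom o)) :
    Defs.iinv (@aut_fun _ c _ (imap h (op_in e))) =
    op_in (s := N) (emap (fun s (x : @carrier N s) =>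
      Defs.iinv (@aut_fun _ c s (imap h x))) e).
  rewrite -{1}(emapK (@imapK _ _ h) e).
  by rewrite (@aut_op _ c o (emap (@imap _ _ h) e)) /= imapK.
by exists (Aut fK gK frel fop) => s x; apply: iinvK.
Qed.

End Restriction.

(** * From a section to a set of imaginaries *)

Section FromSection.
Variables (N M : structure) (h : interp N M).
Variable gh : {multiplicative aut N -> aut M}.
Hypotheses (Mfin : locally_finite M) (ghc : continuous_hom gh)
  (ghK : cancel gh (hat h)).

Local Notation A := (fixed_imaginaries (range gh)).

(** The stabiliser lies in the closure of [range gh], and continuity of both [gh] and the
    restriction makes that range closed. *)
Lemma stab_section (a : aut M) : stab A a <-> gh (hat h a) = a.
Proof.
split=> [Aa|<- X [_ AX]]; last by apply: AX; exists (hat h a).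
apply: aut_eq => s x; have [F [Ffin Fgh]] := ghc x.
have [F' F'fin loc] := hat_local h Ffin.
have [_ [c _ <-] cF] : exists2 b, range gh b & agree (existT _ s x |` F') b a.
  apply: stab_fixed_imaginaries => //.
  - by exists 1%g => //; rewrite multiplicative1.
  - by move=> _ _ [b _ <-] [c _ <-]; exists (b * c)%g; rewrite ?gmulfM.
  - by move=> _ [b _ <-]; exists (b^-1)%g; rewrite ?multiplicativeV.
  - by rewrite finite_setU; split; [apply: finite_set1|].
(* The restriction of [a] is [c] times an automorphism fixing [F], and [gh] sends the latter to one
   fixing [x]. *)
rewrite -(mulVKg c (hat h a)) gmulfM -(cF (existT _ s x)); last by left.
congr (aut_fun (gh c) _); apply: Fgh => y Fy.
have /loc/(_ y Fy) : agree F' (gh c) a by move=> z F'z; apply: cF; right.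
rewrite ghK => cy.
by rewrite -[LHS]/(aut_inv c (aut_fun (hat h a) (tagged y))) -cy aut_funK.
Qed.

(** Both the surjectivity of the interpretation and condition (1) come down to this trivial
    kernel. *)
Lemma stab_section_hat1 (a : aut M) : stab A a -> hat h a = 1%g -> a = 1%g.
Proof. by move=> /stab_section {2}<- ->; rewrite multiplicative1. Qed.

(** The lift is a value of [gh]. Hence invariance under [stab A] on the image is invariance under
    all its automorphisms, which yields the embedding property and condition (2). *)
Lemma section_image_aut (c : aut (image_structure h)) :
  exists2 a, stab A a & hat (inclusion h) a = c.
Proof.
have [b bc] := aut_of_image c.
exists (gh b); first by apply/stab_section; rewrite ghK.
apply: aut_eq => s x; rewrite -(iinvK x) -bc /=.
by rewrite -imap_hat ghK.
Qed.

Lemma section_embedding : interp_embedding (interp_over A (inclusion h)).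
Proof.
move=> w R HR c e; have [a Aa <-] := section_image_aut c.
have [a' a'E] := stab_expansion Aa.
have := HR a' e; congr (R _ <-> R _).
by apply: env_eq => s v; rewrite -a'E; apply: (@act_expansion _ A a').
Qed.

Lemma section_surjection : interp_surjection (interp_over A (inclusion h)).
Proof.
move=> _ [[t z] _ <-] a ha; apply/home_fix.
suff a1 : reduct a = 1%g by exact: (congr1 (fun b : aut M => @aut_fun M b t z) a1).
apply: stab_section_hat1; first exact: stab_reduct.
apply: aut_eq => s x /=.
have /ha/actE_fix /= E : range (imapE (interp_over A (inclusion h)))
    (imapE (interp_over A (inclusion h)) (existT _ s (imap h x))).
  by exists (existT _ s (imap h x)).
rewrite -[RHS](@imapK _ _ h); congr (Defs.iinv _); rewrite -[RHS]E.
by apply: esym; apply: act_expansion.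
Qed.

Lemma section_corresponding :
  corresponding_hom (interp_over A (inclusion h)) gh.
Proof.
move=> b; have [|a aE] := @stab_expansion _ A (gh b).
  by apply/stab_section; rewrite ghK.
exists a => // s x; rewrite -(ghK b) imap_hat -aE.
exact: act_expansion.
Qed.

Lemma section_generates : range (home M) `<=` dcl_eq (range (imapE h) `|` A).
Proof.
move=> _ [z _ <-]; split; last exact: home_first_order.
move=> a ha; rewrite (@stab_section_hat1 a); first exact/home_fix.
  by move=> X AX; apply: ha; right.
by apply/stab_imageP => X hX; apply: ha; left.
Qed.

Lemma section_dcl :
  dcl_in_image h A `&` dcl_eq (range (home (image_structure h))) =
  dcl_eq (M := image_structure h) set0.
Proof.
apply/seteqP; split=> X [HX]; last move=> Xfo.
  move=> [_ Xfo]; split=> // c _.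
  by have [a Aa <-] := section_image_aut c; apply: HX.
by split=> [a Aa|]; [apply: HX|split=> // a _; apply: HX].
Qed.

End FromSection.

(** * From a set of imaginaries to a section *)

Section FromImaginaries.
Variables (N M : structure) (h : interp N M) (A : set (MEq M))
  (g : interp (image_structure h) (expansion A)).
Hypotheses (Mfin : locally_finite M) (hatT : range (hat h) = setT)
  (g_incl : same_interp g (interp_over A (inclusion h)))
  (g_emb : interp_embedding g)
  (gen : range (home M) `<=` dcl_eq (range (imapE h) `|` A)).

(** The definable bijection identifying [g] with the inclusion sends [imap g x] to [x], so it is the
    inverse of [g]. *)
Lemma iinv_equivariant (a : aut (expansion A)) s (x : El (isort g s)) :
  Defs.iinv (act a x) = act (reduct a) (Defs.iinv x) :> El (isort h s).
Proof.
have [phi [_ phi_imap phi_act]] := g_incl.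
have phiE (y : El (isort g s)) : Defs.iinv y = phi s y.
  by rewrite -[in RHS](iinvK y) phi_imap.
by rewrite !phiE phi_act; apply: act_expansion.
Qed.

Lemma hat_image (a : aut (expansion A)) s (x : El (isort h s)) :
  @aut_fun _ (hat g a) s x = act (reduct a) x.
Proof. by rewrite /= iinv_equivariant imapK. Qed.

(** The quotient [a^-1 * b] fixes both the image of [N] and [A], so condition (1) makes it
    trivial. *)
Lemma stab_hat_inj (a b : aut M) :
  stab A a -> stab A b -> hat h a = hat h b -> a = b.
Proof.
move=> Aa Ab ab; suff c1 : (a^-1 * b = 1)%g by rewrite -[a]mulg1 -c1 mulVKg.
have hV : hat h a^-1%g = (hat h a)^-1%g := multiplicativeV (hat h) a.
have hc1 : hat h (a^-1 * b)%g = 1%g by rewrite hatM hV ab mulVg.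
apply: aut_eq => s x; apply/(home_fix _ (existT _ s x)).
have [+ _] : dcl_eq (range (imapE h) `|` A) (home M (existT _ s x)).
  by apply: gen; exists (existT _ s x).
apply=> X [hX|AX]; first by move/stab_imageP: hc1; apply.
by apply: (stabM (stabV Aa) Ab).
Qed.

(* The embedding hypothesis says that [hat h @` stab A] has no more invariant
   relations than [aut N], so it has the same orbits on finite tuples. *)
Lemma stab_hat_dense (b : aut N) (F : set (pts N)) : finite_set F ->
  exists2 a, stab A a & agree F (hat h a) b.
Proof.
move=> /epts_enum[w [n <-]].
pose R : set (env (@carrier (image_structure h)) w) :=
  [set e | exists2 a, stab A a &
     e = emap (fun s => @act M a (isort h s)) (emap (@imap _ _ h) n)].
have Rdef : definable R.
  apply: g_emb => a e /=.
  have -> : emap (@Defs.iinv _ _ g) (emap (fun s => @act _ a (isort g s)) e) =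
      emap (fun s => @act _ (reduct a) (isort h s)) (emap (@Defs.iinv _ _ g) e).
    by apply: env_eq => s v; apply: iinv_equivariant.
  split=> -[c Ac E].
    exists ((reduct a)^-1 * c)%g.
      by apply: stabM Ac; apply/stabV/stab_reduct.
    apply: env_eq => s v; rewrite [RHS]actM.
    have := congr1 (fun u : env _ _ => act (reduct a)^-1%g (u s v)) E.
    by rewrite /emap actK.
  exists (reduct a * c)%g; first by apply: stabM Ac; apply: stab_reduct.
  by apply: env_eq => s v; rewrite [RHS]actM E.
(* A lift [a0] of [b] to [M] need not fix [A], but its restriction preserves the orbit [R], which
   contains the image of [n]. *)
have [a0 _ a0b] : range (hat h) b by rewrite hatT.
have [] := proj2 (Rdef (hat (inclusion h) a0) (emap (@imap _ _ h) n)).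
  by exists 1%g; [apply: stab1|apply: env_eq => s v; rewrite /emap act1].
move=> a Aa E; exists a => //; rewrite -a0b; apply/agree_emap/env_eq => s v.
by congr (Defs.iinv _); apply: esym; apply: (congr1 (fun u : env _ _ => u s v) E).
Qed.

(** Agreement with [b] at each point is a closed condition, and density meets any finitely many of
    them within [stab A]; compactness meets them all. *)
Lemma stab_hat_surj (b : aut N) : exists2 a, stab A a & hat h a = b.
Proof.
have [|D Dfin|a [Aa ab]] := @aut_compact M (pts N) (stab A)
    (fun x => [set a | agree [set x] (hat h a) b]) Mfin (@stab_closed M A).
- by move=> x; apply: hat_closed; apply: finite_set1.
- have [a Aa ab] := stab_hat_dense b Dfin.
  by exists a; split=> // x Dx _ ->; apply: ab.
- by exists a => //; apply: aut_eq => s x; apply: (ab (existT _ s x) (existT _ s x)).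
Qed.

Lemma stab_section_exists : exists gh : {multiplicative aut N -> aut M},
  [/\ corresponding_hom g gh, forall f, corresponding_hom g f -> f =1 gh,
      continuous_hom gh, injective gh & cancel gh (hat h)].
Proof.
pose f b := s2val (cid2 (stab_hat_surj b)).
have fA b : stab A (f b) := s2valP (cid2 (stab_hat_surj b)).
have fK : cancel f (hat h) by move=> b; apply: s2valP' (cid2 (stab_hat_surj b)).
have fM : {morph f : a b / (a * b)%g}.
  by move=> a b; apply: stab_hat_inj; rewrite ?hatM ?fK //; apply: stabM.
pose gh : {multiplicative aut N -> aut M} :=
  HB.pack f (isMultiplicative.Build (aut N) (aut M) f fM).
exists gh; split=> [b|f' f'g b|t y||] //; last exact: (can_inj fK).
- have [a aE] := stab_expansion (fA b); exists a => // s x.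
  by rewrite hat_image aE -imap_hat fK.
- have [a aE ag] := f'g b; apply: stab_hat_inj; rewrite ?fK //.
    by rewrite -aE; apply: stab_reduct.
  by apply: aut_eq => s x; rewrite -aE /= -hat_image ag imapK.
(* If continuity fails at [y], then for each finite [D] some element of [stab A] moves [y] while its
   restriction fixes [D]. By compactness one element moves [y] and restricts to the identity,
   against injectivity. *)
- apply: contrapT => noF.
  have [|D Dfin|a [[Aa ay] a1]] := @aut_compact M (pts N)
      (stab A `&` [set a | aut_fun a y <> y])
      (fun x => [set a | agree [set x] (hat h a) 1%g]) Mfin
      (aut_closedI (@stab_closed M A) (@moving_closed _ _ y)).
  + by move=> x; apply: hat_closed; apply: finite_set1.
  + apply: contrapT => noa; apply: noF; exists D; split=> // b bD.
    apply: contrapT => nby; apply: noa; exists (f b); split=> // x Dx _ ->.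
    by rewrite fK; apply: bD.
  + apply: ay; suff -> : a = 1%g by [].
    apply: stab_hat_inj => //; first exact: stab1.
    rewrite (multiplicative1 (hat h) : hat h 1%g = _); apply: aut_eq => s x.
    exact: (a1 (existT _ s x) (existT _ s x)).
Qed.

End FromImaginaries.

Theorem theorem2p1 (N M : structure) (h : interp N M) :
  finitary N -> finitary M -> interp_embedding h -> exact_restriction h ->
  (forall gh : {multiplicative aut N -> aut M},
     continuous_hom gh -> injective gh -> cancel gh (hat h) ->
     exists2 A : set (MEq M), A `<=` eq_part M &
       let g := interp_over A (inclusion h) in
       [/\ interp_iso g,
           corresponding_hom g gh,
           range (home M) `<=` dcl_eq (range (imapE h) `|` A)
         & dcl_in_image h A `&` dcl_eq (range (home (image_structure h)))
           = dcl_eq (M := image_structure h) set0]) /\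
  (forall (A : set (MEq M)) (g : interp (image_structure h) (expansion A)),
     A `<=` eq_part M ->
     same_interp g (interp_over A (inclusion h)) -> interp_iso g ->
     range (home M) `<=` dcl_eq (range (imapE h) `|` A) ->
     dcl_in_image h A `&` dcl_eq (range (home (image_structure h)))
       = dcl_eq (M := image_structure h) set0 ->
     exists gh : {multiplicative aut N -> aut M},
       [/\ corresponding_hom g gh,
           forall f, corresponding_hom g f -> f =1 gh,
           continuous_hom gh,
           injective gh
         & cancel gh (hat h)]).
Proof.
move=> _ /finitary_locally_finite Mfin _ [_ hatT]; split=> [gh ghc _ ghK|].
  exists (fixed_imaginaries (range gh)); first by move=> X [].
  split; [split|exact: section_corresponding|exact: section_generates
         |exact: section_dcl].
  - exact: section_embedding.
  - exact: section_surjection.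
by move=> A g _ g_incl [g_emb _] gen _; apply: stab_section_exists.
Qed.
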